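(* Let $w=(w(n))_{n\in\mathbb{N}}$ be a bounded, strictly positive sequence such that $$\mathcal{U}_w:=\sup_{m\in\mathbb{N}}\frac{1}{m\,w(m+1)}\sum_{n=m+1}^\infty w(n)<\infty.$$ Then $\mathsf{C}^{(1,w)}$ is power bounded and uniformly mean ergodic.
   Context: The discrete Cesàro operator $\mathsf{C}\colon\mathbb{C}^{\mathbb{N}}\to\mathbb{C}^{\mathbb{N}}$ is the linear map $\mathsf{C}x:=\left(\frac{x_1+\dots+x_n}{n}\right)_{n\in\mathbb{N}}$ for $x=(x_n)_{n\in\mathbb{N}}$, with $\mathbb{N}=\{1,2,\dots\}$. For a bounded, strictly positive sequence $w$, $\ell_1(w):=\{x\in\mathbb{C}^{\mathbb{N}}\colon \sum_{n=1}^\infty w(n)|x_n|<\infty\}$, a Banach space for the norm $\|x\|_{1,w}:=\sum_{n=1}^\infty w(n)|x_n|$. $\mathcal{L}(X)$ is the space of continuous linear operators on a Banach space $X$. $\mathsf{C}^{(1,w)}$ denotes the restriction of $\mathsf{C}$ to $\ell_1(w)$, regarded as an element of $\mathcal{L}(\ell_1(w))$ (the condition $\mathcal{U}_w<\infty$ implies that $\mathsf{C}$ maps $\ell_1(w)$ continuously into itself). For $T\in\mathcal{L}(X)$ let $T_{[n]}:=\frac1n\sum_{m=1}^nT^m$, $n\in\mathbb{N}$. $T$ is power bounded if $\sup_n\|T^n\|<\infty$; uniformly mean ergodic if $\{T_{[n]}\}_{n\in\mathbb{N}}$ converges in the operator norm to some $P\in\mathcal{L}(X)$. *)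

(* Defs.v *)
From Stdlib Require Import Reals Lra Lia FunctionalExtensionality ProofIrrelevance.
From Coquelicot Require Import Coquelicot.

Open Scope R_scope.

(** Sequences indexed by {1, 2, ...} are functions on [nat]: [x n] is the
    (n+1)-st term. *)

(** * Continuous linear operators on a complex normed space *)

(* [is_linear] is Coquelicot's predicate "linear and bounded". *)
Record Lop (X : NormedModule C_AbsRing) := mkLop {
  Lop_fun :> X -> X;
  Lop_is_linear : is_linear Lop_fun }.

Arguments mkLop {X} _ _.
Arguments Lop_fun {X} _ _.
Arguments Lop_is_linear {X} _.

(* The supremum is finite for every [T : Lop X]; see [opnorm_finite]. *)
Definition opnorm {X : NormedModule C_AbsRing} (T : Lop X) : R :=
  real (Lub_Rbar (fun r : R => exists x : X, norm x <= 1 /\ r = norm (T x))).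

Lemma opnorm_finite (X : NormedModule C_AbsRing) (T : Lop X) :
  is_lub_Rbar (fun r : R => exists x : X, norm x <= 1 /\ r = norm (T x))
    (Finite (opnorm T)).
Proof.
unfold opnorm.
set (E := fun r : R => exists x : X, norm x <= 1 /\ r = norm (T x)).
pose proof (Lub_Rbar_correct E) as HL.
destruct (Lop_is_linear T) as [_ _ [M [HM HT]]].
destruct HL as [Hub Hleast].
assert (Hlo : Rbar_le 0 (Lub_Rbar E)).
{ apply Hub. exists zero. rewrite norm_zero. split; [lra|].
  rewrite (linear_zero _ (Lop_is_linear T)). now rewrite norm_zero. }
assert (Hhi : Rbar_le (Lub_Rbar E) M).
{ apply Hleast. intros r [x [Hx ->]]. simpl.
  apply Rle_trans with (1 := HT x).
  rewrite <- (Rmult_1_r M) at 2. apply Rmult_le_compat_l; lra. }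
destruct (Lub_Rbar E) as [l| |]; simpl in Hlo, Hhi; try contradiction.
split; assumption.
Qed.

Lemma is_linear_iter (X : NormedModule C_AbsRing) (T : Lop X) (n : nat) :
  is_linear (fun x : X => Nat.iter n T x).
Proof.
induction n as [|n IH]; simpl.
- apply is_linear_id.
- exact (is_linear_comp _ _ IH (Lop_is_linear T)).
Qed.

Definition Lop_pow {X : NormedModule C_AbsRing} (T : Lop X) (n : nat) : Lop X :=
  mkLop (fun x : X => Nat.iter n T x) (is_linear_iter X T n).

Lemma is_linear_add (X : NormedModule C_AbsRing) (f g : X -> X) :
  is_linear f -> is_linear g -> is_linear (fun x : X => plus (f x) (g x)).
Proof.
intros Hf Hg.
exact (is_linear_comp (fun x : X => (f x, g x)) _
         (is_linear_prod f g Hf Hg) is_linear_plus).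
Qed.

Lemma is_linear_mean (X : NormedModule C_AbsRing) (T : Lop X) (n : nat) :
  is_linear (fun x : X =>
    scal (RtoC (/ INR n) : C_AbsRing)
         (sum_n_m (fun m => Lop_pow T m x) 1 n)).
Proof.
apply (is_linear_comp (fun x => sum_n_m (fun m => Lop_pow T m x) 1 n)).
2: { apply is_linear_scal_r. intros a b. apply Cmult_comm. }
induction n as [|n IH].
- apply is_linear_ext with (l1 := fun _ => zero).
  + intros x. now rewrite sum_n_m_zero by lia.
  + apply is_linear_zero.
- apply is_linear_ext with (l1 := fun x =>
    plus (sum_n_m (fun m => Lop_pow T m x) 1 n) (Lop_pow T (S n) x)).
  + intros x. now rewrite sum_n_Sm by lia.
  + exact (is_linear_add _ _ _ IH (Lop_is_linear (Lop_pow T (S n)))).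
Qed.

Definition Lop_mean {X : NormedModule C_AbsRing} (T : Lop X) (n : nat) : Lop X :=
  mkLop _ (is_linear_mean X T n).

Lemma is_linear_sub (X : NormedModule C_AbsRing) (A B : Lop X) :
  is_linear (fun x : X => minus (A x) (B x)).
Proof.
apply (is_linear_add _ A (fun x => opp (B x))).
- apply Lop_is_linear.
- exact (is_linear_comp _ _ (Lop_is_linear B) is_linear_opp).
Qed.

Definition Lop_minus {X : NormedModule C_AbsRing} (A B : Lop X) : Lop X :=
  mkLop _ (is_linear_sub X A B).

Definition power_bounded {X : NormedModule C_AbsRing} (T : Lop X) : Prop :=
  Rbar_lt (Sup_seq (fun n => Finite (opnorm (Lop_pow T (S n))))) p_infty.

(* [Lop_mean T 0] is a junk value, hence the shift. *)
Definition uniformly_mean_ergodic {X : NormedModule C_AbsRing} (T : Lop X) : Prop :=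
  exists P : Lop X,
    is_lim_seq (fun n => opnorm (Lop_minus (Lop_mean T (S n)) P)) 0.

(** * The weighted space l_1(w) *)

Record weight := mkWeight {
  wt :> nat -> R;
  wt_pos : forall n, 0 < wt n;
  wt_bounded : exists M, forall n, wt n <= M }.

Record ell1 (w : weight) := mkEll1 {
  ell1_seq :> nat -> C;
  ell1_summable : ex_series (fun n => w n * Cmod (ell1_seq n)) }.

Arguments mkEll1 {w} _ _.
Arguments ell1_seq {w} _ _.
Arguments ell1_summable {w} _.

Section Ell1.

Variable w : weight.

Lemma ell1_ext (x y : ell1 w) : (forall n, x n = y n) -> x = y.
Proof.
destruct x as [x Hx], y as [y Hy]; simpl; intros H.
assert (E : x = y) by (apply functional_extensionality; exact H).
subst y. f_equal. apply proof_irrelevance.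
Qed.

Lemma wt_nonneg (n : nat) : 0 <= w n.
Proof. apply Rlt_le, wt_pos. Qed.

Lemma wmod_nonneg (x : nat -> C) (n : nat) : 0 <= w n * Cmod (x n).
Proof. apply Rmult_le_pos; [apply wt_nonneg | apply Cmod_ge_0]. Qed.

Lemma ex_series_dom (a b : nat -> R) :
  (forall n, 0 <= a n <= b n) -> ex_series b -> ex_series a.
Proof.
intros H. apply (ex_series_le (V := R_CompleteNormedModule)).
intros n. change (Rabs (a n) <= b n). rewrite Rabs_pos_eq; apply H.
Qed.

Lemma wmod_plus (x y : nat -> C) (n : nat) :
  0 <= w n * Cmod (Cplus (x n) (y n)) <= w n * Cmod (x n) + w n * Cmod (y n).
Proof.
split; [apply (wmod_nonneg (fun n => Cplus (x n) (y n)))|].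
rewrite <- Rmult_plus_distr_l.
apply Rmult_le_compat_l; [apply wt_nonneg | apply Cmod_triangle].
Qed.

Lemma ell1_plus_summable (x y : ell1 w) :
  ex_series (fun n => w n * Cmod (Cplus (x n) (y n))).
Proof.
apply ex_series_dom with (1 := wmod_plus x y).
exact (ex_series_plus _ _ (ell1_summable x) (ell1_summable y)).
Qed.

Lemma wmod_scal (c : C) (x : nat -> C) (n : nat) :
  Cmod c * (w n * Cmod (x n)) = w n * Cmod (Cmult c (x n)).
Proof. rewrite Cmod_mult. ring. Qed.

Lemma ell1_scal_summable (c : C) (x : ell1 w) :
  ex_series (fun n => w n * Cmod (Cmult c (x n))).
Proof.
apply ex_series_ext with (1 := wmod_scal c x).
exact (ex_series_scal_l (Cmod c) _ (ell1_summable x)).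
Qed.

Lemma ell1_zero_summable : ex_series (fun n => w n * Cmod (RtoC 0)).
Proof.
exists 0. apply is_series_ext with (a := fun _ => 0).
- intros n. rewrite Cmod_0. simpl. ring.
- apply filterlim_ext with (f := fun _ => 0).
  + intros n. rewrite sum_n_const. ring.
  + apply filterlim_const.
Qed.

Lemma ell1_opp_summable (x : ell1 w) :
  ex_series (fun n => w n * Cmod (Copp (x n))).
Proof.
apply ex_series_ext with (2 := ell1_summable x).
intros n. now rewrite Cmod_opp.
Qed.

Definition ell1_plus (x y : ell1 w) : ell1 w :=
  mkEll1 (fun n => Cplus (x n) (y n)) (ell1_plus_summable x y).
Definition ell1_zero : ell1 w := mkEll1 (fun _ => RtoC 0) ell1_zero_summable.
Definition ell1_opp (x : ell1 w) : ell1 w :=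
  mkEll1 (fun n => Copp (x n)) (ell1_opp_summable x).
Definition ell1_scal (c : C) (x : ell1 w) : ell1 w :=
  mkEll1 (fun n => Cmult c (x n)) (ell1_scal_summable c x).

Definition ell1_norm (x : ell1 w) : R := Series (fun n => w n * Cmod (x n)).

Definition ell1_ball (x : ell1 w) (e : R) (y : ell1 w) : Prop :=
  ell1_norm (ell1_plus y (ell1_opp x)) < e.

Lemma ell1_norm_triangle (x y : ell1 w) :
  ell1_norm (ell1_plus x y) <= ell1_norm x + ell1_norm y.
Proof.
unfold ell1_norm.
rewrite <- Series_plus by apply ell1_summable.
apply Series_le; [exact (wmod_plus x y)|].
exact (ex_series_plus _ _ (ell1_summable x) (ell1_summable y)).
Qed.

Lemma ell1_norm_scal (c : C) (x : ell1 w) :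
  ell1_norm (ell1_scal c x) = Cmod c * ell1_norm x.
Proof.
unfold ell1_norm. rewrite <- Series_scal_l.
apply Series_ext. intros n. symmetry. apply wmod_scal.
Qed.

Lemma ell1_norm_opp (x : ell1 w) : ell1_norm (ell1_opp x) = ell1_norm x.
Proof. apply Series_ext. intros n. simpl. now rewrite Cmod_opp. Qed.

Lemma ell1_norm_coord (x : ell1 w) (n : nat) :
  w n * Cmod (x n) <= ell1_norm x.
Proof.
unfold ell1_norm.
set (a := fun n => w n * Cmod (x n)).
assert (Ha : forall k, 0 <= a k) by (intros k; apply (wmod_nonneg x)).
change (a n <= Series a).
apply Rle_trans with (sum_n a n).
- destruct n as [|n]; [rewrite sum_O; apply Rle_refl|].
  rewrite sum_Sn. change plus with Rplus. simpl.
  assert (0 <= sum_n a n); [|lra].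
  apply Rle_trans with (a O); [apply Ha|].
  clear -Ha. induction n as [|n IH]; [rewrite sum_O; apply Rle_refl|].
  rewrite sum_Sn. change plus with Rplus. simpl. specialize (Ha (S n)). lra.
- apply (is_lim_seq_incr_compare (sum_n a)).
  + exact (Series_correct _ (ell1_summable x)).
  + intros k. rewrite sum_Sn. change plus with Rplus. simpl.
    specialize (Ha (S k)). lra.
Qed.

Lemma ell1_norm_eq0 (x : ell1 w) : ell1_norm x = 0 -> x = ell1_zero.
Proof.
intros H. apply ell1_ext. intros n. simpl.
apply Cmod_eq_0.
pose proof (ell1_norm_coord x n) as Hn. rewrite H in Hn.
pose proof (Cmod_ge_0 (x n)). pose proof (wt_pos w n). nra.
Qed.

Definition ell1_AbelianMonoid_mixin : AbelianMonoid.mixin_of (ell1 w).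
Proof.
apply (AbelianMonoid.Mixin (ell1 w) ell1_plus ell1_zero).
- intros x y. apply ell1_ext. intros n. apply Cplus_comm.
- intros x y z. apply ell1_ext. intros n. apply Cplus_assoc.
- intros x. apply ell1_ext. intros n. apply Cplus_0_r.
Defined.

Canonical ell1_AbelianMonoid :=
  AbelianMonoid.Pack (ell1 w) ell1_AbelianMonoid_mixin (ell1 w).

Definition ell1_AbelianGroup_mixin : AbelianGroup.mixin_of ell1_AbelianMonoid.
Proof.
apply (AbelianGroup.Mixin ell1_AbelianMonoid ell1_opp).
intros x. apply ell1_ext. intros n. apply Cplus_opp_r.
Defined.

Canonical ell1_AbelianGroup :=
  AbelianGroup.Pack (ell1 w)
    (AbelianGroup.Class _ ell1_AbelianMonoid_mixin ell1_AbelianGroup_mixin)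
    (ell1 w).

Definition ell1_ModuleSpace_mixin :
  ModuleSpace.mixin_of C_AbsRing ell1_AbelianGroup.
Proof.
apply (ModuleSpace.Mixin C_AbsRing ell1_AbelianGroup ell1_scal).
- intros a b x. apply ell1_ext. intros n. apply Cmult_assoc.
- intros x. apply ell1_ext. intros n. apply Cmult_1_l.
- intros a x y. apply ell1_ext. intros n. apply Cmult_plus_distr_l.
- intros a b x. apply ell1_ext. intros n. apply Cmult_plus_distr_r.
Defined.

Canonical ell1_ModuleSpace :=
  ModuleSpace.Pack C_AbsRing (ell1 w)
    (ModuleSpace.Class _ _ (AbelianGroup.class ell1_AbelianGroup)
       ell1_ModuleSpace_mixin)
    (ell1 w).

Definition ell1_UniformSpace_mixin : UniformSpace.mixin_of (ell1 w).
Proof.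
apply (UniformSpace.Mixin (ell1 w) ell1_zero ell1_ball).
- intros x e. unfold ell1_ball.
  replace (ell1_plus x (ell1_opp x)) with (ell1_scal (RtoC 0) x).
  + rewrite ell1_norm_scal, Cmod_0, Rmult_0_l. apply cond_pos.
  + apply ell1_ext. intros n. simpl. ring.
- intros x y e. unfold ell1_ball.
  replace (ell1_plus x (ell1_opp y)) with (ell1_opp (ell1_plus y (ell1_opp x))).
  + now rewrite ell1_norm_opp.
  + apply ell1_ext. intros n. simpl. ring.
- intros x y z e1 e2. unfold ell1_ball. intros H1 H2.
  replace (ell1_plus z (ell1_opp x))
    with (ell1_plus (ell1_plus z (ell1_opp y)) (ell1_plus y (ell1_opp x))).
  + apply Rle_lt_trans with (1 := ell1_norm_triangle _ _). lra.
  + apply ell1_ext. intros n. simpl. ring.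
Defined.

Canonical ell1_UniformSpace :=
  UniformSpace.Pack (ell1 w) ell1_UniformSpace_mixin (ell1 w).

Canonical ell1_NormedModuleAux :=
  NormedModuleAux.Pack C_AbsRing (ell1 w)
    (NormedModuleAux.Class _ _ (ModuleSpace.class _ ell1_ModuleSpace)
       ell1_UniformSpace_mixin)
    (ell1 w).

Definition ell1_NormedModule_mixin :
  NormedModule.mixin_of C_AbsRing ell1_NormedModuleAux.
Proof.
apply (NormedModule.Mixin C_AbsRing ell1_NormedModuleAux ell1_norm 1).
- exact ell1_norm_triangle.
- intros c x. apply Req_le. exact (ell1_norm_scal c x).
- intros x y e H. exact H.
- intros x y e H. rewrite Rmult_1_l. exact H.
- exact ell1_norm_eq0.
Defined.

Canonical ell1_NormedModule :=
  NormedModule.Pack C_AbsRing (ell1 w)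
    (NormedModule.Class _ _ (NormedModuleAux.class _ ell1_NormedModuleAux)
       ell1_NormedModule_mixin)
    (ell1 w).

End Ell1.

(** * The discrete Cesàro operator *)

Definition cesaro (x : nat -> C) (n : nat) : C :=
  Cdiv (sum_n x n) (RtoC (INR (S n))).

(* With m counted from 0, the term is (1/((m+1) w_{m+2})) sum_{n >= m+2} w_n.
   The inner sum is the extended-real limit of the partial sums, so a
   divergent series of weights gives [p_infty]. *)
Definition U_w (w : nat -> R) : Rbar :=
  Sup_seq (fun m =>
    Rbar_mult (Finite (/ (INR (S m) * w (S m))))
              (Lim_seq (sum_n (fun k => w (S m + k)%nat)))).

Section CesaroEll1.

Variable w : weight.
Hypothesis hU : Rbar_lt (U_w w) p_infty.

Lemma sum_n_SR (a : nat -> R) (n : nat) : sum_n a (S n) = sum_n a n + a (S n).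
Proof. now rewrite sum_Sn. Qed.

Lemma sum_n_nonneg (a : nat -> R) (n : nat) :
  (forall k, 0 <= a k) -> 0 <= sum_n a n.
Proof.
intros Ha. induction n as [|n IH]; [rewrite sum_O; apply Ha|].
rewrite sum_n_SR. specialize (Ha (S n)). lra.
Qed.

Lemma ex_series_bounded (a : nat -> R) (M : R) :
  (forall k, 0 <= a k) -> (forall n, sum_n a n <= M) -> ex_series a.
Proof.
intros Ha HM.
destruct (ex_finite_lim_seq_incr (sum_n a) M) as [l Hl].
- intros n. rewrite sum_n_SR. specialize (Ha (S n)). lra.
- exact HM.
- exists l. exact Hl.
Qed.

Lemma Series_bounded (a : nat -> R) (M : R) :
  ex_series a -> (forall n, sum_n a n <= M) -> Series a <= M.
Proof.
intros Hex HM.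
pose proof (is_lim_seq_le (sum_n a) (fun _ => M) (Series a) M HM
              (Series_correct _ Hex) (is_lim_seq_const M)) as H.
exact H.
Qed.

Lemma sum_n_le_Series (a : nat -> R) (n : nat) :
  (forall k, 0 <= a k) -> ex_series a -> sum_n a n <= Series a.
Proof.
intros Ha Hex. apply (is_lim_seq_incr_compare (sum_n a)).
- exact (Series_correct _ Hex).
- intros k. rewrite sum_n_SR. specialize (Ha (S k)). lra.
Qed.

Lemma Series_nonneg (a : nat -> R) :
  (forall k, 0 <= a k) -> ex_series a -> 0 <= Series a.
Proof.
intros Ha Hex. apply Rle_trans with (sum_n a 0).
- now apply sum_n_nonneg.
- now apply sum_n_le_Series.
Qed.

Lemma weight_tail_bound : exists U : R, 0 <= U /\ forall m,
  ex_series (fun k => w (S m + k)%nat) /\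
  Series (fun k => w (S m + k)%nat) <= U * (INR (S m) * w (S m)).
Proof.
assert (HS : forall m, exists l : R, 0 <= l /\
   is_series (fun k => w (S m + k)%nat) l /\
   Rbar_le (Finite (/ (INR (S m) * w (S m)) * l)) (U_w w)).
{ intros m.
  set (a := fun k => w (S m + k)%nat).
  assert (Ha : forall k, 0 <= a k) by (intros k; apply wt_nonneg).
  assert (Hpos : 0 < / (INR (S m) * w (S m))).
  { apply Rinv_0_lt_compat, Rmult_lt_0_compat; [apply lt_0_INR; lia|apply wt_pos]. }
  assert (Hinc : forall n, sum_n a n <= sum_n a (S n)).
  { intros n. rewrite sum_n_SR. specialize (Ha (S n)). lra. }
  pose proof (proj1 (is_sup_seq_lub _ _ (Sup_seq_correct
    (fun m => Rbar_mult (Finite (/ (INR (S m) * w (S m))))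
       (Lim_seq (sum_n (fun k => w (S m + k)%nat))))))) as Hub.
  specialize (Hub _ (ex_intro _ m eq_refl)). fold (U_w w) in Hub. fold a in Hub.
  pose proof (ex_lim_seq_incr _ Hinc) as Hex.
  apply Lim_seq_correct in Hex.
  assert (H0 : Rbar_le 0 (Lim_seq (sum_n a))).
  { apply (is_lim_seq_le (fun _ => 0) (sum_n a) 0); [|apply is_lim_seq_const|exact Hex].
    intros n. now apply sum_n_nonneg. }
  destruct (Lim_seq (sum_n a)) as [l| |] eqn:E; simpl in H0; try contradiction.
  - exists l. split; [exact H0|]. split; [exact Hex|exact Hub].
  - exfalso.
    rewrite (is_Rbar_mult_unique _ _ p_infty) in Hub.
    + destruct (U_w w); simpl in Hub, hU; contradiction.
    + apply is_Rbar_mult_sym, is_Rbar_mult_p_infty_pos. exact Hpos. }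
assert (HUf : exists U, U_w w = Finite U).
{ destruct (HS O) as [l [_ [_ Hl]]].
  destruct (U_w w) as [u| |]; simpl in Hl, hU; try contradiction. now exists u. }
destruct HUf as [U HUf]. rewrite HUf in HS.
exists (Rmax U 0). split; [apply Rmax_r|].
intros m. destruct (HS m) as [l [Hl0 [Hl HlU]]]. split; [now exists l|].
rewrite (is_series_unique _ _ Hl). simpl in HlU.
assert (Hpos : 0 < INR (S m) * w (S m)).
{ apply Rmult_lt_0_compat; [apply lt_0_INR; lia|apply wt_pos]. }
change (match m with 0%nat => 1 | S _ => INR m + 1 end) with (INR (S m)) in HlU.
apply Rle_trans with (U * (INR (S m) * w (S m))).
- apply (Rmult_le_compat_r (INR (S m) * w (S m))) in HlU; [|lra].
  replace l with (/ (INR (S m) * w (S m)) * l * (INR (S m) * w (S m))).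
  + exact HlU.
  + field. split; apply Rgt_not_eq; [apply wt_pos|apply lt_0_INR; lia].
- apply Rmult_le_compat_r; [lra|apply Rmax_l].
Qed.

Lemma cesaro_column_bound : exists K : R, 0 < K /\ forall n,
  ex_series (fun k => w (n + k)%nat / INR (S (n + k))) /\
  Series (fun k => w (n + k)%nat / INR (S (n + k))) <= K * w n.
Proof.
destruct weight_tail_bound as [U [HU0 HU]].
assert (Hterm : forall n k,
  0 <= w (n + k)%nat / INR (S (n + k)) <= / INR (S n) * w (n + k)%nat).
{ intros n k. pose proof (wt_nonneg w (n + k)).
  assert (0 < INR (S n)) by (apply lt_0_INR; lia).
  assert (0 < INR (S (n + k))) by (apply lt_0_INR; lia).
  assert (/ INR (S (n + k)) <= / INR (S n))
    by (apply Rinv_le_contravar; [assumption|apply le_INR; lia]).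
  assert (0 < / INR (S (n + k))) by now apply Rinv_0_lt_compat.
  unfold Rdiv. split; [nra|]. rewrite Rmult_comm. nra. }
assert (Hpos : forall m,
  ex_series (fun k => w (S m + k)%nat / INR (S (S m + k))) /\
  Series (fun k => w (S m + k)%nat / INR (S (S m + k))) <= U * w (S m)).
{ intros m. destruct (HU m) as [Hex Hle].
  pose proof (ex_series_scal_l (/ INR (S (S m))) _ Hex) as Hex'.
  split; [exact (ex_series_dom _ _ (Hterm (S m)) Hex')|].
  apply Rle_trans with (1 := Series_le _ _ (Hterm (S m)) Hex').
  rewrite Series_scal_l.
  pose proof (wt_pos w (S m)).
  assert (Hm : 0 < INR (S m)) by (apply lt_0_INR; lia).
  assert (Hi : 0 < / INR (S (S m))) by (apply Rinv_0_lt_compat, lt_0_INR; lia).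
  apply Rle_trans with (/ INR (S (S m)) * (U * (INR (S m) * w (S m)))).
  { apply Rmult_le_compat_l; lra. }
  replace (/ INR (S (S m)) * (U * (INR (S m) * w (S m))))
    with ((/ INR (S (S m)) * INR (S m)) * (U * w (S m))) by ring.
  rewrite <- (Rmult_1_l (U * w (S m))) at 2.
  apply Rmult_le_compat_r; [apply Rmult_le_pos; lra|].
  rewrite (S_INR (S m)) in Hi |- *.
  apply Rle_trans with (/ (INR (S m) + 1) * (INR (S m) + 1)).
  - apply Rmult_le_compat_l; lra.
  - rewrite Rinv_l by lra. apply Rle_refl. }
assert (Hex0 : ex_series (fun k => w (0 + k)%nat / INR (S (0 + k)))).
{ apply ex_series_incr_1. apply (proj1 (Hpos O)). }
set (R0 := Series (fun k => w (0 + k)%nat / INR (S (0 + k)))) in *.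
pose proof (wt_pos w 0) as Hw0.
exists (Rmax (Rmax U (R0 / w 0%nat)) 1).
set (K := Rmax _ 1).
assert (HK1 : 1 <= K) by apply Rmax_r.
assert (HKU : U <= K) by (eapply Rle_trans; [apply Rmax_l|apply Rmax_l]).
assert (HKR : R0 / w 0%nat <= K) by (eapply Rle_trans; [apply Rmax_r|apply Rmax_l]).
split; [lra|].
intros [|m].
- split; [exact Hex0|]. fold R0.
  replace R0 with (R0 / w 0%nat * w 0%nat) by (field; lra).
  apply Rmult_le_compat_r; lra.
- destruct (Hpos m) as [Hex Hle]. split; [exact Hex|].
  pose proof (wt_pos w (S m)). apply Rle_trans with (1 := Hle).
  apply Rmult_le_compat_r; lra.
Qed.

Lemma Cmod_sum_n (x : nat -> C) (n : nat) :
  Cmod (sum_n x n) <= sum_n (fun k => Cmod (x k)) n.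
Proof.
induction n as [|n IH]; [rewrite !sum_O; apply Rle_refl|].
rewrite sum_n_SR, (sum_Sn x).
apply Rle_trans with (1 := Cmod_triangle _ _). lra.
Qed.

Lemma cesaro_wmod (x : nat -> C) (n : nat) :
  0 <= w n * Cmod (cesaro x n) <=
    w n / INR (S n) * sum_n (fun k => Cmod (x k)) n.
Proof.
split; [apply (wmod_nonneg w (cesaro x))|].
assert (Hn : 0 < INR (S n)) by (apply lt_0_INR; lia).
unfold cesaro. rewrite Cmod_div by (intros E; apply RtoC_inj in E; lra).
rewrite Cmod_R, (Rabs_pos_eq (INR (S n))) by lra.
unfold Rdiv. rewrite (Rmult_comm (Cmod _)), <- Rmult_assoc.
apply Rmult_le_compat_l; [|apply Cmod_sum_n].
apply Rmult_le_pos; [apply wt_nonneg|apply Rlt_le; now apply Rinv_0_lt_compat].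
Qed.

Lemma cesaro_bound : exists K : R, 0 < K /\ forall x : ell1 w,
  ex_series (fun n => w n * Cmod (cesaro x n)) /\
  Series (fun n => w n * Cmod (cesaro x n)) <= K * ell1_norm w x.
Proof.
destruct cesaro_column_bound as [K [HK Hcol]].
exists K. split; [exact HK|]. intros x.
set (q := fun n => w n / INR (S n)).
set (Rt := fun n => Series (fun k => q (n + k)%nat)).
set (a := fun n => Cmod (x n)).
assert (Ha : forall n, 0 <= a n) by (intros n; apply Cmod_ge_0).
assert (Hq : forall n, 0 <= q n).
{ intros n. apply Rmult_le_pos; [apply wt_nonneg|].
  apply Rlt_le, Rinv_0_lt_compat, lt_0_INR; lia. }
assert (HRt : forall n, 0 <= Rt n).
{ intros n. apply Series_nonneg; [intros k; apply Hq|apply (proj1 (Hcol n))]. }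
assert (Hstep : forall n, Rt n = q n + Rt (S n)).
{ intros n. unfold Rt. rewrite Series_incr_1 by apply (proj1 (Hcol n)).
  rewrite Nat.add_0_r. f_equal. apply Series_ext. intros k.
  now rewrite Nat.add_succ_r. }
assert (Habel : forall N, sum_n (fun n => q n * sum_n a n) N =
   sum_n (fun n => Rt n * a n) N - Rt (S N) * sum_n a N :> R).
{ induction N as [|N IH].
  - rewrite !sum_O. rewrite (Hstep O). ring.
  - rewrite !sum_n_SR, IH, (Hstep (S N)). ring. }
assert (HKx : ex_series (fun n => K * (w n * a n))).
{ exact (ex_series_scal_l K _ (ell1_summable x)). }
assert (HN : forall N, sum_n (fun n => q n * sum_n a n) N <= K * ell1_norm w x).
{ intros N. rewrite Habel.
  apply Rle_trans with (sum_n (fun n => K * (w n * a n)) N).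
  - pose proof (HRt (S N)). pose proof (sum_n_nonneg a N Ha).
    assert (sum_n (fun n => Rt n * a n) N <= sum_n (fun n => K * (w n * a n)) N).
    { apply sum_n_m_le. intros n. rewrite <- Rmult_assoc.
      apply Rmult_le_compat_r; [apply Ha|apply (proj2 (Hcol n))]. }
    nra.
  - unfold ell1_norm. rewrite <- Series_scal_l.
    apply sum_n_le_Series; [|exact HKx].
    intros k. apply Rmult_le_pos; [lra|apply (wmod_nonneg w x)]. }
assert (Hdom : ex_series (fun n => q n * sum_n a n)).
{ apply ex_series_bounded with (2 := HN).
  intros n. apply Rmult_le_pos; [apply Hq|now apply sum_n_nonneg]. }
split; [exact (ex_series_dom _ _ (cesaro_wmod x) Hdom)|].
apply Rle_trans with (1 := Series_le _ _ (cesaro_wmod x) Hdom).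
exact (Series_bounded _ _ Hdom HN).
Qed.

Lemma cesaro_summable (x : ell1 w) :
  ex_series (fun n => w n * Cmod (cesaro x n)).
Proof. destruct cesaro_bound as [K [_ H]]. apply H. Qed.

Definition cesaro_ell1_fun (x : ell1 w) : ell1 w :=
  mkEll1 (cesaro x) (cesaro_summable x).

Lemma cesaro_ell1_is_linear : is_linear cesaro_ell1_fun.
Proof.
constructor.
- intros x y. apply ell1_ext. intros n. simpl. unfold cesaro.
  change (fun n => Cplus (x n) (y n)) with (fun n => plus (x n) (y n)).
  rewrite sum_n_plus. apply Cmult_plus_distr_r.
- intros c x. apply ell1_ext. intros n. simpl. unfold cesaro.
  pose proof (sum_n_mult_l (K := C_Ring) c x n) as E.
  change (sum_n (fun k => Cmult c (x k)) n = Cmult c (sum_n x n)) in E.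
  rewrite E. symmetry. apply Cmult_assoc.
- destruct cesaro_bound as [K [HK H]]. exists K. split; [exact HK|].
  intros x. exact (proj2 (H x)).
Qed.

Definition cesaro_ell1 : Lop (ell1_NormedModule w) :=
  mkLop cesaro_ell1_fun cesaro_ell1_is_linear.

End CesaroEll1.

(* Main.v *)
Require Import Defs.
From Stdlib Require Import Reals Lra Lia.
From Coquelicot Require Import Coquelicot.

Open Scope R_scope.

(** Let [P x] be the constant sequence with value the first term of [x], so that
    [C P = P] and [y := x - P x] has first term [0].  For a nonnegative sequence
    [a] with first term [0], the sequence [b_n := a_n + sum_(2 <= k <= n) a_k / (k-1)]
    solves [b - C b = a].  Since [C] is positive, induction gives the pointwise
    bounds [|C^m y| <= b] and [|C y + ... + C^m y| <= b - a] for [a := |y|].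
    Exchanging the sums, the norm of [b - a] is at most
    [sum_k |y_k| / (k-1) * sum_(n >= k) w_n <= U_w * ||y||].  Hence [C^m] is
    bounded and the means converge to [P] at rate [O(1/m)]. *)

(** * Operator norms, powers and means of a bounded operator *)

Lemma opnorm_le (X : NormedModule C_AbsRing) (T : Lop X) (K : R) :
  0 <= K -> (forall x, norm (T x) <= K * norm x) -> opnorm T <= K.
Proof.
intros HK HT.
apply (proj2 (opnorm_finite X T) (Finite K)).
intros r [x [Hx ->]]. simpl.
apply Rle_trans with (1 := HT x).
rewrite <- (Rmult_1_r K) at 2. now apply Rmult_le_compat_l.
Qed.

Lemma opnorm_ge_0 (X : NormedModule C_AbsRing) (T : Lop X) : 0 <= opnorm T.
Proof.
apply (proj1 (opnorm_finite X T) 0).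
exists zero. rewrite norm_zero. split; [lra|].
rewrite (linear_zero _ (Lop_is_linear T)). now rewrite norm_zero.
Qed.

Lemma power_bounded_le (X : NormedModule C_AbsRing) (T : Lop X) (K : R) :
  (forall n, opnorm (Lop_pow T (S n)) <= K) -> power_bounded T.
Proof.
intros HK. unfold power_bounded.
apply Rbar_le_lt_trans with (Finite K); [|exact I].
apply (proj2 (is_sup_seq_lub _ _ (Sup_seq_correct _))).
intros r [n ->]. exact (HK n).
Qed.

(** Horner form of the sum of powers: each induction step on such sums then costs a single
    application of [T]. *)
Lemma sum_pow_succ (X : NormedModule C_AbsRing) (T : Lop X) (x : X) (n : nat) :
  sum_n_m (fun m => Lop_pow T m x) 1 (S n) =
  T (plus (sum_n_m (fun m => Lop_pow T m x) 1 n) x).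
Proof.
induction n as [|n IH].
- rewrite sum_n_n, sum_n_m_zero by lia. now rewrite plus_zero_l.
- rewrite (sum_n_Sm _ 1 (S n)) by lia. rewrite IH at 1.
  rewrite (sum_n_Sm _ 1 n) by lia.
  set (s := sum_n_m _ 1 n).
  rewrite <- plus_assoc, (plus_comm (Lop_pow T (S n) x)), plus_assoc.
  symmetry. apply (linear_plus _ (Lop_is_linear T)).
Qed.

Lemma Lop_pow_fixed (X : NormedModule C_AbsRing) (T : Lop X) (p : X) (n : nat) :
  T p = p -> Lop_pow T n p = p.
Proof.
intros Hp. simpl. induction n as [|n IH]; simpl; [reflexivity|].
now rewrite IH.
Qed.

Lemma Lop_mean_fixed (X : NormedModule C_AbsRing) (T : Lop X) (p : X) (n : nat) :
  T p = p -> Lop_mean T (S n) p = p.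
Proof.
intros Hp.
assert (E : forall k, sum_n_m (fun m => Lop_pow T m p) 1 k
                      = scal (RtoC (INR k) : C_AbsRing) p).
{ induction k as [|k IH].
  - rewrite sum_n_m_zero by lia. symmetry. apply (scal_zero_l p).
  - rewrite sum_n_Sm, IH, Lop_pow_fixed by (assumption || lia).
    rewrite S_INR, RtoC_plus.
    transitivity (plus (scal (RtoC (INR k) : C_AbsRing) p)
                       (scal (one : C_AbsRing) p)).
    + now rewrite scal_one.
    + symmetry. apply (scal_distr_r (RtoC (INR k) : C_AbsRing)). }
change (Lop_mean T (S n) p) with
  (scal (RtoC (/ INR (S n)) : C_AbsRing)
     (sum_n_m (fun m => Lop_pow T m p) 1 (S n))).
rewrite E, scal_assoc.
replace (mult _ _) with (one : C_AbsRing); [apply scal_one|].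
change (RtoC 1 = Cmult (RtoC (/ INR (S n))) (RtoC (INR (S n)))).
rewrite <- RtoC_mult. f_equal. field. apply not_0_INR. lia.
Qed.

(** * Pointwise majorants for the Cesàro operator *)

(* With [a 0 = 0] this is [b - a] for the solution [b] of [b - C b = a]; the
   term at [k = 0] is then [0 / 0 = 0]. *)
Definition harmonic_sum (a : nat -> R) (n : nat) : R :=
  sum_n (fun k => a k / INR k) n.

Lemma harmonic_sum_nonneg (a : nat -> R) (n : nat) :
  a O = 0 -> (forall k, 0 <= a k) -> 0 <= harmonic_sum a n.
Proof.
intros H0 Ha. apply sum_n_nonneg. intros [|k].
- rewrite H0. unfold Rdiv. lra.
- apply Rdiv_le_0_compat; [apply Ha|apply lt_0_INR; lia].
Qed.

(** This is [C b = b - a] cleared of its denominator. With [h := harmonic_sum a], the induction step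
    rests on [(n+1) * (h (n+1) - h n) = a (n+1)]. *)
Lemma sum_harmonic_sum (a : nat -> R) (n : nat) : a O = 0 ->
  sum_n (fun k => a k + harmonic_sum a k) n = INR (S n) * harmonic_sum a n :> R.
Proof.
intros H0. induction n as [|n IH].
- unfold harmonic_sum. rewrite !sum_O, H0. unfold Rdiv. ring.
- rewrite sum_n_SR, IH. unfold harmonic_sum. rewrite !sum_n_SR.
  rewrite (S_INR (S n)). field. apply not_0_INR. lia.
Qed.

(** Positivity of the averages: [|z| <= b] gives [|C z| <= C b = b - a]. This is the step shared by
    the two inductions on powers. *)
Lemma Cmod_cesaro_le (z : nat -> C) (a : nat -> R) (n : nat) : a O = 0 ->
  (forall k, Cmod (z k) <= a k + harmonic_sum a k) ->
  Cmod (cesaro z n) <= harmonic_sum a n.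
Proof.
intros H0 Hz.
assert (Hn : 0 < INR (S n)) by (apply lt_0_INR; lia).
unfold cesaro. rewrite Cmod_div by (intros E; apply RtoC_inj in E; lra).
rewrite Cmod_R, (Rabs_pos_eq (INR (S n))) by lra.
apply (Rmult_le_reg_l (INR (S n))); [exact Hn|].
replace (INR (S n) * (Cmod (sum_n z n) / INR (S n))) with (Cmod (sum_n z n))
  by (field; lra).
rewrite <- sum_harmonic_sum by exact H0.
apply Rle_trans with (1 := Cmod_sum_n z n).
now apply sum_n_m_le.
Qed.

Lemma cesaro_const (c : C) (n : nat) : cesaro (fun _ => c) n = c.
Proof.
assert (E : forall k, sum_n (fun _ => c) k = Cmult (RtoC (INR (S k))) c :> C).
{ induction k as [|k IH].
  - rewrite sum_O. simpl. ring.
  - rewrite sum_Sn, IH, (S_INR (S k)), RtoC_plus.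
    change plus with Cplus. ring. }
unfold cesaro. rewrite E. field.
intros H. apply RtoC_inj in H. revert H. apply not_0_INR. lia.
Qed.

(** * Norm estimates on the weighted space and the limit projection *)

Section CesaroPowers.

Variable w : weight.
Hypothesis hU : Rbar_lt (U_w w) p_infty.

(** Puts the constant sequences into [ell1 w], so that the limit projection acts on that space. *)
Lemma weight_summable : ex_series w.
Proof.
destruct (weight_tail_bound w hU) as [U [_ HU]].
apply ex_series_incr_1. exact (proj1 (HU O)).
Qed.

Lemma first_coord_summable (x : ell1 w) :
  ex_series (fun n => w n * Cmod (x O)).
Proof. exact (ex_series_scal_r (Cmod (x O)) _ weight_summable). Qed.

Definition const_proj_fun (x : ell1 w) : ell1 w :=
  mkEll1 (fun _ => x O) (first_coord_summable x).

Lemma const_proj_norm (x : ell1 w) :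
  ell1_norm w (const_proj_fun x) <= Series w / w O * ell1_norm w x.
Proof.
unfold ell1_norm at 1. simpl. rewrite Series_scal_r.
pose proof (wt_pos w O) as Hw.
pose proof (ell1_norm_coord w x O) as Hx.
pose proof (Series_nonneg w (wt_nonneg w) weight_summable) as HW.
replace (Series w * Cmod (x O)) with (Series w / w O * (w O * Cmod (x O)))
  by (field; lra).
apply Rmult_le_compat_l; [now apply Rdiv_le_0_compat|exact Hx].
Qed.

Lemma const_proj_is_linear :
  is_linear (U := ell1_NormedModule w) (V := ell1_NormedModule w) const_proj_fun.
Proof.
constructor.
- intros x y. now apply ell1_ext.
- intros c x. now apply ell1_ext.
(* [is_linear] asks for a strictly positive constant, hence the [+ 1]. *)
- exists (Series w / w O + 1). split.
  + pose proof (Series_nonneg w (wt_nonneg w) weight_summable) as HW.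
    pose proof (Rdiv_le_0_compat _ _ HW (wt_pos w O)). lra.
  + intros x. apply Rle_trans with (1 := const_proj_norm x).
    apply Rmult_le_compat_r; [exact (norm_ge_0 (V := ell1_NormedModule w) x)|lra].
Qed.

Definition const_proj : Lop (ell1_NormedModule w) :=
  mkLop const_proj_fun const_proj_is_linear.

Lemma cesaro_const_proj (x : ell1 w) :
  cesaro_ell1 w hU (const_proj x) = const_proj x.
Proof. apply ell1_ext. intros n. exact (cesaro_const (x O) n). Qed.

Lemma harmonic_norm_bound : exists U : R, 0 <= U /\ forall y z : ell1 w,
  y O = RtoC 0 ->
  (forall n, Cmod (z n) <= harmonic_sum (fun k => Cmod (y k)) n) ->
  ell1_norm w z <= U * ell1_norm w y.
Proof.
destruct (weight_tail_bound w hU) as [U [HU0 HU]].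
exists U. split; [exact HU0|]. intros y z Hy0 Hz.
set (a := fun k => Cmod (y k)) in *.
assert (Ha0 : a O = 0) by (unfold a; now rewrite Hy0, Cmod_0).
assert (Ha : forall k, 0 <= a k) by (intros k; apply Cmod_ge_0).
set (tail := fun n => Series (fun k => w (n + k)%nat)).
assert (Hex : forall n, ex_series (fun k => w (n + k)%nat)).
{ intros [|n]; [exact weight_summable|exact (proj1 (HU n))]. }
assert (Htail : forall n, 0 <= tail n).
{ intros n. apply Series_nonneg; [intros k; apply wt_nonneg|apply Hex]. }
assert (Hstep : forall n, tail n = w n + tail (S n)).
{ intros n. unfold tail. rewrite Series_incr_1 by apply Hex.
  rewrite Nat.add_0_r. f_equal. apply Series_ext. intros k.
  now rewrite Nat.add_succ_r. }
(* Summation by parts with [w n = tail n - tail (S n)] is the finite form of the exchange of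
   sums. *)
assert (Habel : forall N, sum_n (fun n => w n * harmonic_sum a n) N =
  sum_n (fun n => tail n * (a n / INR n)) N - tail (S N) * harmonic_sum a N :> R).
{ induction N as [|N IH].
  - unfold harmonic_sum. rewrite !sum_O, (Hstep O). ring.
  - rewrite !sum_n_SR, IH, (Hstep (S N)). unfold harmonic_sum.
    rewrite !sum_n_SR. ring. }
(* The factor [INR n] in the bound on [tail n] cancels the denominator. At [n = 0], where [U] does
   not control the tail, [a 0 = 0] makes both sides vanish. *)
assert (Hterm : forall n, tail n * (a n / INR n) <= U * (w n * a n)).
{ intros [|n].
  - rewrite Ha0. unfold Rdiv. lra.
  - assert (Hn : 0 < INR (S n)) by (apply lt_0_INR; lia).
    replace (U * (w (S n) * a (S n)))
      with (U * (INR (S n) * w (S n)) * (a (S n) / INR (S n))) by (field; lra).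
    apply Rmult_le_compat_r; [|apply (proj2 (HU n))].
    now apply Rdiv_le_0_compat. }
apply Series_bounded; [apply ell1_summable|]. intros N.
apply Rle_trans with (sum_n (fun n => w n * harmonic_sum a n) N).
{ apply sum_n_m_le. intros n.
  apply Rmult_le_compat_l; [apply wt_nonneg|apply Hz]. }
rewrite Habel.
apply Rle_trans with (sum_n (fun n => U * (w n * a n)) N).
(* The boundary term is nonnegative and is dropped. *)
- pose proof (Rmult_le_pos _ _ (Htail (S N)) (harmonic_sum_nonneg a N Ha0 Ha)).
  pose proof (sum_n_m_le _ _ 0 N Hterm) as Hle.
  fold (sum_n (fun n => tail n * (a n / INR n)) N) in Hle.
  fold (sum_n (fun n => U * (w n * a n)) N) in Hle. lra.
- unfold ell1_norm. rewrite <- Series_scal_l.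
  apply sum_n_le_Series.
  + intros k. apply Rmult_le_pos; [exact HU0|apply (wmod_nonneg w y)].
  + exact (ex_series_scal_l U _ (ell1_summable y)).
Qed.

(** Start from [|y| = a <= b]; every application of [C] gives a bound by [b - a], which is again at
    most [b]. *)
Lemma cesaro_pow_le (y : ell1 w) (m n : nat) : y O = RtoC 0 ->
  Cmod (ell1_seq (Lop_pow (cesaro_ell1 w hU) (S m) y) n) <=
    harmonic_sum (fun k => Cmod (y k)) n.
Proof.
intros Hy.
assert (H0 : (fun k => Cmod (y k)) O = 0) by (now rewrite Hy, Cmod_0).
revert n. induction m as [|m IH]; intros n;
  apply Cmod_cesaro_le; try exact H0; intros k.
- pose proof (harmonic_sum_nonneg _ k H0 (fun j => Cmod_ge_0 (y j))).
  simpl. lra.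
- apply Rle_trans with (1 := IH k). pose proof (Cmod_ge_0 (y k)). lra.
Qed.

(** If a partial sum [s] satisfies [|s| <= b - a], then [|s + y| <= b], and the next sum [C (s + y)]
    is again at most [b - a]. The bound is independent of [m], so dividing by [m] yields the
    rate. *)
Lemma cesaro_sum_pow_le (y : ell1 w) (m n : nat) : y O = RtoC 0 ->
  Cmod (ell1_seq (sum_n_m (fun j => Lop_pow (cesaro_ell1 w hU) j y) 1 m) n) <=
    harmonic_sum (fun k => Cmod (y k)) n.
Proof.
intros Hy.
assert (H0 : (fun k => Cmod (y k)) O = 0) by (now rewrite Hy, Cmod_0).
revert n. induction m as [|m IH]; intros n.
- rewrite sum_n_m_zero by lia.
  change (Cmod (RtoC 0) <= harmonic_sum (fun k => Cmod (y k)) n).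
  rewrite Cmod_0. apply harmonic_sum_nonneg; [exact H0|].
  intros k. apply Cmod_ge_0.
- rewrite sum_pow_succ.
  apply Cmod_cesaro_le; [exact H0|]. intros k.
  apply Rle_trans with (1 := Cmod_triangle _ _).
  rewrite Rplus_comm. apply Rplus_le_compat_l, IH.
Qed.

Lemma cesaro_ell1_bounds : exists K : R, 0 <= K /\
  (forall m, opnorm (Lop_pow (cesaro_ell1 w hU) (S m)) <= K) /\
  (forall m, opnorm (Lop_minus (Lop_mean (cesaro_ell1 w hU) (S m)) const_proj)
     <= K * / INR (S m)).
Proof.
destruct harmonic_norm_bound as [U [HU0 HU]].
set (T := cesaro_ell1 w hU).
set (p := Series w / w O).
assert (Hp : 0 <= p).
{ apply Rdiv_le_0_compat; [|apply wt_pos].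
  exact (Series_nonneg w (wt_nonneg w) weight_summable). }
set (r := fun x : ell1_NormedModule w => minus x (const_proj x)).
assert (Hr0 : forall x, ell1_seq (r x) O = RtoC 0).
{ intros x. exact (Cplus_opp_r (ell1_seq x O)). }
assert (Hrx : forall x, x = plus (r x) (const_proj x)).
{ intros x. unfold r, minus.
  now rewrite <- plus_assoc, plus_opp_l, plus_zero_r. }
assert (HP : forall x, norm (const_proj x) <= p * norm x) by exact const_proj_norm.
assert (HUr : forall x, U * norm (r x) <= U * (1 + p) * norm x).
{ intros x. rewrite Rmult_assoc. apply Rmult_le_compat_l; [exact HU0|].
  unfold r, minus. apply Rle_trans with (1 := norm_triangle _ _).
  rewrite norm_opp. specialize (HP x). lra. }
assert (HUp : 0 <= U * (1 + p)) by (apply Rmult_le_pos; lra).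
(* [1 + p] bounds the map [r], [U] bounds powers and their sums on its range, and the last [p]
   accounts for the fixed part [const_proj x]. *)
exists (U * (1 + p) + p). split; [lra|]. split; intros m.
- apply opnorm_le; [lra|]. intros x.
  rewrite (Hrx x) at 1.
  rewrite (linear_plus _ (Lop_is_linear (Lop_pow T (S m)))).
  rewrite (Lop_pow_fixed _ T _ _ (cesaro_const_proj x)).
  apply Rle_trans with (1 := norm_triangle _ _).
  pose proof (HU (r x) (Lop_pow T (S m) (r x)) (Hr0 x)
    (fun n => cesaro_pow_le _ m n (Hr0 x))) as H.
  change (norm (Lop_pow T (S m) (r x)) <= U * norm (r x)) in H.
  specialize (HP x). specialize (HUr x). lra.
- assert (Hm : 0 < / INR (S m)) by (apply Rinv_0_lt_compat, lt_0_INR; lia).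
  apply opnorm_le; [apply Rmult_le_pos; lra|]. intros x.
  change (Lop_minus (Lop_mean T (S m)) const_proj x) with
    (minus (Lop_mean T (S m) x) (const_proj x)).
  rewrite (Hrx x) at 1.
  rewrite (linear_plus _ (Lop_is_linear (Lop_mean T (S m)))).
  rewrite (Lop_mean_fixed _ T _ _ (cesaro_const_proj x)).
  (* The fixed part cancels against the limit, leaving only the mean applied to [r x]. *)
  assert (E : forall u v : ell1_NormedModule w, minus (plus u v) v = u).
  { intros u v. apply ell1_ext. intros n. simpl. ring. }
  rewrite E.
  apply Rle_trans with (1 := norm_scal _ _).
  change (abs (RtoC (/ INR (S m)) : C_AbsRing)) with (Cmod (RtoC (/ INR (S m)))).
  rewrite Cmod_R, Rabs_pos_eq by lra.
  rewrite (Rmult_comm _ (/ _)), Rmult_assoc.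
  apply Rmult_le_compat_l; [lra|].
  pose proof (HU (r x) (sum_n_m (fun j => Lop_pow T j (r x)) 1 (S m)) (Hr0 x)
    (fun n => cesaro_sum_pow_le _ (S m) n (Hr0 x))) as H.
  change (norm (sum_n_m (fun j => Lop_pow T j (r x)) 1 (S m)) <= U * norm (r x)) in H.
  apply Rle_trans with (1 := H). apply Rle_trans with (1 := HUr x).
  apply Rmult_le_compat_r; [apply norm_ge_0|lra].
Qed.

End CesaroPowers.

Theorem proposition4p12 (w : nat -> R)
    (w_pos : forall n, 0 < w n)
    (w_bounded : exists M, forall n, w n <= M)
    (hU : Rbar_lt (U_w w) p_infty) :
  power_bounded (cesaro_ell1 (mkWeight w w_pos w_bounded) hU) /\
  uniformly_mean_ergodic (cesaro_ell1 (mkWeight w w_pos w_bounded) hU).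
Proof.
destruct (cesaro_ell1_bounds (mkWeight w w_pos w_bounded) hU)
  as [K [HK [Hpow Hmean]]].
split; [exact (power_bounded_le _ _ K Hpow)|].
exists (const_proj (mkWeight w w_pos w_bounded) hU).
apply (is_lim_seq_le_le (fun _ => 0) _ (fun m => K * / INR (S m))).
- intros m. split; [apply opnorm_ge_0|apply Hmean].
- apply is_lim_seq_const.
- replace (Finite 0) with (Rbar_mult K 0) by (simpl; f_equal; ring).
  apply is_lim_seq_scal_l.
  apply (is_lim_seq_inv (fun m => INR (S m)) p_infty); [|discriminate].
  apply (is_lim_seq_incr_1 INR), is_lim_seq_INR.
Qed.
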